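(* Let $l,k,\rho,c,\gamma,q_0,h_0,D_\infty>0$ be given, and consider the coefficient $\epsilon\in(0,1)$ as an unknown of the free boundary problem (P) described in the context. Then the solution of (P), including the unknown coefficient $\epsilon$, is given by, with $\alpha=\frac{k}{\rho c}$, $$T(x,t)=\frac{q_0\sqrt{\pi\alpha}}{k}\left[\operatorname{erf}\left(\frac{x}{2\sqrt{\alpha t}}\right)-\operatorname{erf}(\xi)\right]\quad (0<x<s(t),\ t>0),$$ $$s(t)=2\xi\sqrt{\alpha t},\qquad r(t)=2\left[\xi+\frac{\gamma k}{2q_0\sqrt{\alpha}}\exp(\xi^2)\right]\sqrt{\alpha t}\quad (t>0),$$ with $\epsilon\in(0,1)$ and $\xi>0$ given by $$\epsilon=1-\frac{2q_0}{\gamma\sqrt{k\rho c}}\left(\frac{q_0}{l}\sqrt{\frac{c}{\rho k}}-f_2(\xi)\right)\exp(-2\xi^2),\qquad \xi=\operatorname{erf}^{-1}\left(\frac{D_\infty}{q_0}\sqrt{\frac{k\rho c}{\pi}}\left(1-\frac{q_0}{h_0D_\infty}\right)\right),$$ if and only if the following four inequalities hold: $$1-\frac{q_0}{h_0D_\infty}>0,\qquad \frac{D_\infty}{q_0}\sqrt{\frac{k\rho c}{\pi}}\left(1-\frac{q_0}{h_0D_\infty}\right)<1,$$ $$f_2\left(\operatorname{erf}^{-1}\left(\frac{D_\infty}{q_0}\sqrt{\frac{k\rho c}{\pi}}\left(1-\frac{q_0}{h_0D_\infty}\right)\right)\right)<\frac{q_0}{l}\sqrt{\frac{c}{\rho k}},$$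 $$\frac{\gamma\sqrt{k\rho c}}{2q_0}\exp\left(2\left[\operatorname{erf}^{-1}\left(\frac{D_\infty}{q_0}\sqrt{\frac{k\rho c}{\pi}}\left(1-\frac{q_0}{h_0D_\infty}\right)\right)\right]^2\right)+f_2\left(\operatorname{erf}^{-1}\left(\frac{D_\infty}{q_0}\sqrt{\frac{k\rho c}{\pi}}\left(1-\frac{q_0}{h_0D_\infty}\right)\right)\right)>\frac{q_0}{l}\sqrt{\frac{c}{\rho k}},$$ where $f_2(x)=x\exp(x^2)$ for $x>0$. (That is: there exist $\epsilon\in(0,1)$ and $\xi>0$ such that the triple $(T,s,r)$ with $T(x,t)=\frac{q_0\sqrt{\pi\alpha}}{k}\left[\operatorname{erf}\left(\frac{x}{2\sqrt{\alpha t}}\right)-\operatorname{erf}(\xi)\right]$, $s(t)=2\xi\sqrt{\alpha t}$ and $r(t)=2\left[\xi+\frac{\gamma k}{2q_0\sqrt{\alpha}}\exp(\xi^2)\right]\sqrt{\alpha t}$ solves (P) if and only if these inequalities hold, and in that case $\xi=\operatorname{erf}^{-1}\left(\frac{D_\infty}{q_0}\sqrt{\frac{k\rho c}{\pi}}\left(1-\frac{q_0}{h_0D_\infty}\right)\right)$ and $\epsilon=1-\frac{2q_0}{\gamma\sqrt{k\rho c}}\left(\frac{q_0}{l}\sqrt{\frac{c}{\rho k}}-f_2(\xi)\right)\exp(-2\xi^2)$.)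
   Context: Problem (P): find $T=T(x,t)$ and free boundaries $x=s(t)$, $x=r(t)$ such that $$\rho c\,T_t(x,t)-kT_{xx}(x,t)=0,\quad 0<x<s(t),\ t>0;$$ $$T(s(t),t)=0,\quad t>0;$$ $$kT_x(s(t),t)=\rho l\,[\epsilon\dot s(t)+(1-\epsilon)\dot r(t)],\quad t>0;$$ $$T_x(s(t),t)\,(r(t)-s(t))=\gamma,\quad t>0;$$ $$r(0)=s(0)=0;$$ $$kT_x(0,t)=\frac{q_0}{\sqrt t},\quad t>0;$$ $$kT_x(0,t)=\frac{h_0}{\sqrt t}\,(T(0,t)+D_\infty),\quad t>0.$$ All parameters $l,k,\rho,c,\gamma,q_0,h_0,D_\infty$ are positive real constants and $0<\epsilon<1$. Here $T$ and $T_x$ at $x=0$ and $x=s(t)$ are the boundary values from $0<x<s(t)$. The error function is $\operatorname{erf}(x)=\frac{2}{\sqrt\pi}\int_0^x e^{-u^2}\,du$, and $\operatorname{erf}^{-1}:(0,1)\to(0,\infty)$ is the inverse of its restriction to $(0,\infty)$. The third and fourth inequalities are only considered when the first two hold, so that $\operatorname{erf}^{-1}$ is defined. *)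

(* Defs.v *)
From Stdlib Require Import Reals ClassicalEpsilon.
From Coquelicot Require Import Coquelicot.
Open Scope R_scope.

Definition erf (x : R) : R :=
  2 / sqrt PI * RInt (fun u => exp (- u ^ 2)) 0 x.

(* Inverse of the restriction of [erf] to the positive half-line. It is only
   meaningful on the interval (0,1); elsewhere its value is unspecified. *)
Definition erf_inv (y : R) : R :=
  epsilon (inhabits 0) (fun x => 0 < x /\ erf x = y).

Definition f2 (x : R) : R := x * exp (x ^ 2).

(* [T x t] is only constrained for [0 < t] and [0 < x < s t]. The values of
   [T] and [T_x] at [x = 0] and [x = s t] are one-sided limits, at fixed [t],
   from inside this interval; [T0], [p0] and [ps] stand for the boundary values
   of [T] at 0, of [T_x] at 0 and of [T_x] at [s t]. *)
Record solves_P (l k rho c gamma q0 h0 Dinf eps : R)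
    (T : R -> R -> R) (s r : R -> R) : Prop := {
  (* Implicit in the problem: the phase [0 < x < s t] is nonempty. *)
  P_domain : forall t, 0 < t -> 0 < s t;
  (* [ex_derive_n f 2 x] alone would not give differentiability of [f]. *)
  P_regular : forall x t, 0 < t -> 0 < x < s t ->
    ex_derive (fun tau => T x tau) t /\
    ex_derive (fun y => T y t) x /\
    ex_derive_n (fun y => T y t) 2 x;
  P_heat : forall x t, 0 < t -> 0 < x < s t ->
    rho * c * Derive (fun tau => T x tau) t
      - k * Derive_n (fun y => T y t) 2 x = 0;
  P_front_regular : forall t, 0 < t -> ex_derive s t /\ ex_derive r t;
  P_front_temperature : forall t, 0 < t ->
    filterlim (fun x => T x t) (at_left (s t)) (locally 0);
  P_front_flux : forall t, 0 < t -> exists ps : R,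
    filterlim (Derive (fun y => T y t)) (at_left (s t)) (locally ps) /\
    k * ps = rho * l * (eps * Derive s t + (1 - eps) * Derive r t) /\
    ps * (r t - s t) = gamma;
  P_initial : r 0 = 0 /\ s 0 = 0;
  P_fixed_face : forall t, 0 < t -> exists T0 p0 : R,
    filterlim (fun x => T x t) (at_right 0) (locally T0) /\
    filterlim (Derive (fun y => T y t)) (at_right 0) (locally p0) /\
    k * p0 = q0 / sqrt t /\
    k * p0 = h0 / sqrt t * (T0 + Dinf)
}.

Definition T_sol (k alpha q0 xi x t : R) : R :=
  q0 * sqrt (PI * alpha) / k * (erf (x / (2 * sqrt (alpha * t))) - erf xi).

Definition s_sol (alpha xi t : R) : R := 2 * xi * sqrt (alpha * t).

Definition r_sol (k alpha gamma q0 xi t : R) : R :=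
  2 * (xi + gamma * k / (2 * q0 * sqrt alpha) * exp (xi ^ 2)) * sqrt (alpha * t).

(* Main.v *)
(** For the similarity profile every condition of (P) holds identically in [xi]
    and [eps] except two: the convective condition at [x = 0], which reduces to
    [erf xi = y], and the energy balance on [x = s t], which, divided by
    [rho l sqrt alpha exp (- xi^2) / sqrt t], becomes the linear equation
    [q0 / l sqrt (c / (rho k)) - f2 xi = (1 - eps) K exp (2 xi^2)] in [eps], where
    [K = gamma sqrt (k rho c) / (2 q0)]. The first is solvable with [xi > 0] iff
    [0 < y < 1]; the last two inequalities say that the second gives [0 < eps < 1].

    That [erf] tends to 1 follows from the Gaussian integral: the sum of the square
    of the integral of [exp (- u^2)] over [0, x] and of the integral of
    [exp (- x^2 (1 + t^2)) / (1 + t^2)] over [t] in [0, 1] has zero derivative in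
    [x], hence always equals [atan 1]. *)
Require Import Defs.
From Stdlib Require Import Reals Lra ClassicalEpsilon.
From Coquelicot Require Import Coquelicot.
Open Scope R_scope.

(** * The Gaussian integral *)

Lemma continuous_gauss (x : R) : continuous (fun u => exp (- u ^ 2)) x.
Proof.
apply (ex_derive_continuous (fun u => exp (- u ^ 2))); auto_derive; exact I.
Qed.

Lemma ex_RInt_gauss (a b : R) : ex_RInt (fun u => exp (- u ^ 2)) a b.
Proof. apply (ex_RInt_continuous (V := R_CompleteNormedModule)); intros; apply continuous_gauss. Qed.

Lemma is_derive_RInt_gauss (x : R) :
  is_derive (fun x => RInt (fun u => exp (- u ^ 2)) 0 x) x (exp (- x ^ 2)).
Proof.
apply (is_derive_RInt (fun u => exp (- u ^ 2))) with 0.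
- apply filter_forall; intros z; apply (RInt_correct (V := R_CompleteNormedModule)), ex_RInt_gauss.
- apply continuous_gauss.
Qed.

(** The denominator cancels against the factor [1 + t ^ 2] produced by differentiating in [x], and
    at [x = 0] what remains is the derivative of [atan]. *)
Definition gauss_kernel (x t : R) : R := exp (- (x ^ 2 * (1 + t ^ 2))) / (1 + t ^ 2).

Lemma one_plus_sqr_pos (t : R) : 0 < 1 + t ^ 2.
Proof. nra. Qed.

Lemma is_derive_gauss_kernel (x t : R) :
  is_derive (fun x => gauss_kernel x t) x (-2 * x * exp (- (x ^ 2 * (1 + t ^ 2)))).
Proof.
pose proof (one_plus_sqr_pos t).
unfold gauss_kernel; auto_derive; [simpl in *; lra|].
simpl; field; simpl in *; lra.
Qed.

Lemma Derive_gauss_kernel (x t : R) :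
  Derive (fun x => gauss_kernel x t) x = -2 * x * exp (- (x ^ 2 * (1 + t ^ 2))).
Proof. apply is_derive_unique, is_derive_gauss_kernel. Qed.

Lemma ex_RInt_gauss_kernel (x : R) : ex_RInt (gauss_kernel x) 0 1.
Proof.
apply (ex_RInt_continuous (V := R_CompleteNormedModule)); intros t _.
apply (ex_derive_continuous (gauss_kernel x)).
pose proof (one_plus_sqr_pos t).
unfold gauss_kernel; auto_derive; simpl in *; lra.
Qed.

(** Differentiation under the integral sign gives the integrand [-2 x exp (- x^2) exp (- (x t)^2)],
    and the substitution [u = x t] absorbs the factor [x]. *)
Lemma is_derive_RInt_gauss_kernel (x : R) :
  is_derive (fun x => RInt (gauss_kernel x) 0 1) x
    (-2 * exp (- x ^ 2) * RInt (fun u => exp (- u ^ 2)) 0 x).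
Proof.
replace (-2 * exp (- x ^ 2) * RInt (fun u => exp (- u ^ 2)) 0 x)
  with (RInt (fun t => Derive (fun u => gauss_kernel u t) x) 0 1).
- apply (is_derive_RInt_param gauss_kernel 0 1 x).
  + apply filter_forall; intros z t _.
    eexists; apply is_derive_gauss_kernel.
  + intros t _.
    (* Powers are spelled out as products so that joint continuity follows from the rules for sums
       and products. *)
    apply continuity_2d_pt_ext with (fun u v => -2 * u * exp (- (u * u * (1 + v * v)))).
    { intros u v; symmetry; rewrite Derive_gauss_kernel.
      do 2 f_equal; ring. }
    apply continuity_2d_pt_mult.
    { apply continuity_2d_pt_mult;
        [apply continuity_2d_pt_const | apply continuity_2d_pt_id1]. }
    apply (continuity_1d_2d_pt_comp exp (fun u v => - (u * u * (1 + v * v)))).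
    { apply derivable_continuous_pt, derivable_pt_exp. }
    apply continuity_2d_pt_opp.
    repeat first [apply continuity_2d_pt_mult | apply continuity_2d_pt_plus
      | apply continuity_2d_pt_const | apply continuity_2d_pt_id1
      | apply continuity_2d_pt_id2].
  + apply filter_forall; intros z; apply ex_RInt_gauss_kernel.
- pose proof (RInt_comp_lin (fun u => exp (- u ^ 2)) x 0 0 1 (ex_RInt_gauss _ _)) as H.
  replace (x * 0 + 0) with 0 in H by ring.
  replace (x * 1 + 0) with x in H by ring.
  rewrite <- H.
  assert (Hex : ex_RInt (fun t => scal x (exp (- (x * t + 0) ^ 2))) 0 1).
  { apply (ex_RInt_continuous (V := R_CompleteNormedModule)); intros t _.
    apply (ex_derive_continuous (fun t => x * exp (- (x * t + 0) ^ 2))).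
    auto_derive; exact I. }
  refine (eq_trans _ (RInt_scal (V := R_CompleteNormedModule)
    _ 0 1 (-2 * exp (- x ^ 2)) Hex)).
  apply RInt_ext; intros t _.
  rewrite Derive_gauss_kernel.
  unfold scal; simpl; unfold mult; simpl.
  replace (- (x * (x * 1) * (1 + t * (t * 1))))
    with (- (x * (x * 1)) + - ((x * t + 0) * ((x * t + 0) * 1))) by ring.
  rewrite exp_plus; ring.
Qed.

Lemma RInt_gauss_sqr_plus_kernel (x : R) :
  0 <= x -> RInt (fun u => exp (- u ^ 2)) 0 x ^ 2 + RInt (gauss_kernel x) 0 1 = PI / 4.
Proof.
set (I := fun x => RInt (fun u => exp (- u ^ 2)) 0 x).
set (G := fun x => RInt (gauss_kernel x) 0 1).
assert (HD : forall z, is_derive (fun x => I x ^ 2 + G x) z 0).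
{ intros z.
  replace 0 with (plus (2 * exp (- z ^ 2) * I z) (-2 * exp (- z ^ 2) * I z))
    by (unfold plus; simpl; ring).
  apply (is_derive_plus (fun x => I x ^ 2) G).
  - replace (2 * exp (- z ^ 2) * I z) with (INR 2 * exp (- z ^ 2) * I z ^ Nat.pred 2)
      by (simpl; ring).
    apply is_derive_pow, is_derive_RInt_gauss.
  - apply is_derive_RInt_gauss_kernel. }
intros Hx.
assert (H0 : I 0 ^ 2 + G 0 = PI / 4).
{ unfold I, G; rewrite RInt_point.
  (* The constant is found at [x = 0], where the Gaussian integral vanishes and the kernel
     integrates to [atan 1]. *)
  assert (HG : is_RInt (gauss_kernel 0) 0 1 (minus (atan 1) (atan 0))).
  { apply (is_RInt_derive (V := R_CompleteNormedModule) atan).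
    - intros t _; unfold gauss_kernel.
      replace (exp (- (0 ^ 2 * (1 + t ^ 2)))) with 1
        by (rewrite <- exp_0; f_equal; ring).
      apply is_derive_Reals.
      replace (1 / (1 + t ^ 2)) with (/ (1 + t ^ 2)).
      + apply derivable_pt_lim_atan.
      + pose proof (one_plus_sqr_pos t); field; lra.
    - intros t _; apply (ex_derive_continuous (gauss_kernel 0)).
      pose proof (one_plus_sqr_pos t).
      unfold gauss_kernel; auto_derive; simpl in *; lra. }
  rewrite (is_RInt_unique _ _ _ _ HG), atan_1, atan_0.
  unfold minus, plus, opp, zero; simpl; ring. }
change (I x ^ 2 + G x = PI / 4); rewrite <- H0.
destruct (Req_dec x 0) as [-> | Hne]; [reflexivity|].
destruct (MVT_gen (fun x => I x ^ 2 + G x) 0 x (fun _ => 0)) as (w & _ & Hw).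
- intros z _; apply HD.
- intros z _; apply continuity_pt_filterlim.
  apply (ex_derive_continuous (fun x => I x ^ 2 + G x)); eexists; apply HD.
- lra.
Qed.

(** The upper bound comes from [1 + t^2 >= 1] in both exponent and denominator. Positivity will keep
    [erf] below 1; the upper bound will push it towards 1. *)
Lemma RInt_gauss_kernel_bounds (x : R) :
  0 < RInt (gauss_kernel x) 0 1 <= exp (- x ^ 2).
Proof.
split.
- apply RInt_gt_0; [lra| |].
  + intros t _; unfold gauss_kernel; apply Rdiv_lt_0_compat;
      [apply exp_pos | apply one_plus_sqr_pos].
  + intros t _.
    apply (ex_derive_continuous (gauss_kernel x)).
    pose proof (one_plus_sqr_pos t).
    unfold gauss_kernel; auto_derive; simpl in *; lra.
- replace (exp (- x ^ 2)) with (RInt (fun _ => exp (- x ^ 2)) 0 1)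
    by (rewrite RInt_const; unfold scal; simpl; unfold mult; simpl; ring).
  apply RInt_le; [lra | apply ex_RInt_gauss_kernel | apply ex_RInt_const |].
  intros t Ht; unfold gauss_kernel.
  pose proof (one_plus_sqr_pos t).
  apply Rle_trans with (exp (- (x ^ 2 * (1 + t ^ 2)))).
  + apply Rle_div_l; [assumption|].
    pose proof (exp_pos (- (x ^ 2 * (1 + t ^ 2)))); nra.
  + apply Rnot_lt_le; intros H1%exp_lt_inv; pose proof (pow2_ge_0 x); nra.
Qed.

(** * The error function and its inverse *)

Lemma sqrt_PI_pos : 0 < sqrt PI.
Proof. apply sqrt_lt_R0, PI_RGT_0. Qed.

Lemma is_derive_erf (x : R) : is_derive erf x (2 / sqrt PI * exp (- x ^ 2)).
Proof. unfold erf; apply is_derive_scal, is_derive_RInt_gauss. Qed.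

Lemma continuous_erf (x : R) : continuous erf x.
Proof. apply (ex_derive_continuous erf); eexists; apply is_derive_erf. Qed.

Lemma erf_0 : erf 0 = 0.
Proof. unfold erf; rewrite RInt_point; unfold zero; simpl; ring. Qed.

Lemma erf_increasing (x y : R) : x < y -> erf x < erf y.
Proof.
intros Hxy; pose proof sqrt_PI_pos.
apply (incr_function erf m_infty p_infty (fun x => 2 / sqrt PI * exp (- x ^ 2)));
  simpl; auto; intros z _ _.
- apply is_derive_erf.
- apply Rmult_lt_0_compat; [apply Rdiv_lt_0_compat; lra | apply exp_pos].
Qed.

Lemma erf_inj (x y : R) : erf x = erf y -> x = y.
Proof.
intros H; destruct (Rtotal_order x y) as [Hl | [He | Hg]]; [| exact He |].
- apply erf_increasing in Hl; lra.
- apply erf_increasing in Hg; lra.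
Qed.

Lemma erf_pos (x : R) : 0 < x -> 0 < erf x.
Proof. intros Hx; rewrite <- erf_0; now apply erf_increasing. Qed.

(** The Gaussian identity rescaled by [4 / PI], the square of the normalizing factor of [erf]; it
    makes the distance of [erf x ^ 2] from 1 explicit. *)
Lemma erf_sqr (x : R) :
  0 <= x -> erf x ^ 2 = 1 - 4 / PI * RInt (gauss_kernel x) 0 1.
Proof.
intros Hx; pose proof PI_RGT_0; pose proof sqrt_PI_pos.
pose proof (RInt_gauss_sqr_plus_kernel x Hx) as HI.
replace (RInt (gauss_kernel x) 0 1)
  with (PI / 4 - RInt (fun u => exp (- u ^ 2)) 0 x ^ 2) by lra.
unfold erf.
rewrite Rpow_mult_distr.
replace ((2 / sqrt PI) ^ 2) with (4 / PI).
- field; lra.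
- rewrite <- (pow2_sqrt PI) at 1 by lra; field; lra.
Qed.

Lemma erf_lt_1 (x : R) : erf x < 1.
Proof.
destruct (Rle_lt_dec x 0) as [Hx | Hx].
- destruct (Req_dec x 0) as [-> | Hne]; [rewrite erf_0; lra|].
  assert (erf x < erf 0) by (apply erf_increasing; lra).
  rewrite erf_0 in *; lra.
- pose proof (erf_sqr x (Rlt_le _ _ Hx)); pose proof PI_RGT_0.
  assert (0 < 4 / PI) by (apply Rdiv_lt_0_compat; lra).
  pose proof (RInt_gauss_kernel_bounds x); pose proof (erf_pos x Hx); nra.
Qed.

Lemma erf_gt (y : R) : y < 1 -> exists x, 0 < x /\ y < erf x.
Proof.
intros Hy; destruct (Rle_lt_dec y 0) as [Hy0 | Hy0].
{ exists 1; split; [lra|]; pose proof (erf_pos 1 Rlt_0_1); lra. }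
pose proof PI_RGT_0.
(* Chosen so that a kernel integral below [d] means [erf x ^ 2 > y ^ 2]. *)
set (d := PI / 4 * (1 - y ^ 2)).
assert (Hd : 0 < d) by (apply Rmult_lt_0_compat; nra).
set (x := 1 + / d).
assert (Hid : 0 < / d) by now apply Rinv_0_lt_compat.
(* With [x = 1 + / d], the bound [exp (x^2) >= 1 + x^2 > / d] yields [exp (- x^2) < d]. *)
assert (Hx : 0 < x) by (unfold x; lra).
exists x; split; [assumption|].
assert (He : exp (- x ^ 2) < d).
{ rewrite exp_Ropp, <- (Rinv_inv d).
  apply Rinv_lt_contravar; [apply Rmult_lt_0_compat; [assumption | apply exp_pos]|].
  apply Rlt_le_trans with (1 + x ^ 2); [unfold x; nra | apply exp_ineq1_le]. }
pose proof (erf_sqr x (Rlt_le _ _ Hx)) as Hs.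
pose proof (RInt_gauss_kernel_bounds x); pose proof (erf_pos x Hx).
assert (4 / PI * RInt (gauss_kernel x) 0 1 < 1 - y ^ 2).
{ replace (1 - y ^ 2) with (4 / PI * d) by (unfold d; field; lra).
  apply Rmult_lt_compat_l; [apply Rdiv_lt_0_compat|]; lra. }
nra.
Qed.

(** Existence, which the choice operator requires, is the intermediate value theorem between 0 and a
    point where [erf] exceeds [y]; the root is not 0 because [erf 0 = 0 < y]. *)
Lemma erf_inv_spec (y : R) : 0 < y < 1 -> 0 < erf_inv y /\ erf (erf_inv y) = y.
Proof.
intros Hy; unfold erf_inv.
apply (epsilon_spec (inhabits 0) (fun x => 0 < x /\ erf x = y)).
destruct (erf_gt y) as (b & Hb & Hyb); [lra|].
destruct (IVT_gen erf 0 b y) as (x & Hx & Hxy).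
- intros z; apply continuity_pt_filterlim, continuous_erf.
- rewrite erf_0, Rmin_left, Rmax_right; lra.
- rewrite Rmin_left, Rmax_right in Hx by lra.
  exists x; split; [|assumption].
  destruct (Req_dec x 0) as [-> | Hne]; [rewrite erf_0 in Hxy; lra | lra].
Qed.

Lemma erf_inv_erf (x : R) : 0 < x -> erf_inv (erf x) = x.
Proof.
intros Hx; apply erf_inj, erf_inv_spec; split; [now apply erf_pos | apply erf_lt_1].
Qed.

(** * Derivatives of the similarity profile and reduction of (P) to two equations *)

Lemma continuous_within (f : R -> R) (D : R -> Prop) (x : R) :
  continuous f x -> filterlim f (within D (locally x)) (locally (f x)).
Proof. apply filterlim_filter_le_1; intros P; now apply filter_le_within. Qed.

Lemma is_derive_T_sol_x (k alpha q0 xi x t : R) :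
  0 < k -> 0 < alpha -> 0 < t ->
  is_derive (fun y => T_sol k alpha q0 xi y t) x
    (q0 / (k * sqrt t) * exp (- (x / (2 * sqrt (alpha * t))) ^ 2)).
Proof.
intros hk halpha Ht.
pose proof (sqrt_lt_R0 _ halpha); pose proof (sqrt_lt_R0 _ Ht); pose proof sqrt_PI_pos.
pose proof PI_RGT_0.
unfold T_sol; rewrite !sqrt_mult by lra.
auto_derive; [repeat split; eexists; apply is_derive_erf|].
rewrite (is_derive_unique _ _ _ (is_derive_erf _)).
unfold Rdiv; field; lra.
Qed.

Lemma is_derive_T_sol_t (k alpha q0 xi x t : R) :
  0 < k -> 0 < alpha -> 0 < t ->
  is_derive (fun tau => T_sol k alpha q0 xi x tau) t
    (- q0 * x / (2 * k * t * sqrt t) * exp (- (x / (2 * sqrt (alpha * t))) ^ 2)).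
Proof.
intros hk halpha Ht.
pose proof (sqrt_lt_R0 _ halpha); pose proof (sqrt_lt_R0 _ Ht); pose proof sqrt_PI_pos.
pose proof PI_RGT_0.
assert (Hat : 0 < alpha * t) by now apply Rmult_lt_0_compat.
pose proof (sqrt_lt_R0 _ Hat).
unfold T_sol.
auto_derive.
{ repeat split; try lra; eexists; apply is_derive_erf. }
rewrite (is_derive_unique _ _ _ (is_derive_erf _)).
rewrite !(sqrt_mult PI), !(sqrt_mult alpha) by lra.
change (x * / (2 * (sqrt alpha * sqrt t))) with (x / (2 * (sqrt alpha * sqrt t))).
generalize (exp (- (x / (2 * (sqrt alpha * sqrt t))) ^ 2)); intros e.
(* Writing a bare [alpha] and a bare [t] as squares of their roots makes the identity rational in
   those roots. *)
rewrite <- (sqrt_sqrt alpha) at 2 by lra.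
rewrite <- (sqrt_sqrt t) at 4 by lra.
field; lra.
Qed.

Lemma is_derive_T_sol_xx (k alpha q0 x t : R) :
  0 < k -> 0 < alpha -> 0 < t ->
  is_derive (fun x => q0 / (k * sqrt t) * exp (- (x / (2 * sqrt (alpha * t))) ^ 2)) x
    (- q0 * x / (2 * alpha * k * t * sqrt t) * exp (- (x / (2 * sqrt (alpha * t))) ^ 2)).
Proof.
intros hk halpha Ht.
pose proof (sqrt_lt_R0 _ halpha); pose proof (sqrt_lt_R0 _ Ht).
rewrite !sqrt_mult by lra.
auto_derive; [exact I|].
replace (x * / (2 * (sqrt alpha * sqrt t)) * (x * / (2 * (sqrt alpha * sqrt t)) * 1))
  with ((x / (2 * (sqrt alpha * sqrt t))) ^ 2) by (simpl; unfold Rdiv; ring).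
generalize (exp (- (x / (2 * (sqrt alpha * sqrt t))) ^ 2)); intros e.
rewrite <- (sqrt_sqrt alpha) at 3 by lra.
rewrite <- (sqrt_sqrt t) at 4 by lra.
field; lra.
Qed.

(** In both nontrivial conditions the time dependence is a common factor [1 / sqrt t]. The condition
    at one time therefore gives the scalar equation, and the scalar equation gives the condition at
    every time. *)
Lemma solves_P_similarity_iff (l k rho c gamma q0 h0 Dinf eps alpha xi : R) :
  0 < l -> 0 < k -> 0 < rho -> 0 < c -> 0 < q0 -> 0 < h0 -> alpha = k / (rho * c) -> 0 < xi ->
  solves_P l k rho c gamma q0 h0 Dinf eps
    (T_sol k alpha q0 xi) (s_sol alpha xi) (r_sol k alpha gamma q0 xi) <->
  q0 = h0 * (Dinf - q0 * sqrt (PI * alpha) / k * erf xi) /\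
  q0 * exp (- xi ^ 2) = rho * l * sqrt alpha *
    (xi + (1 - eps) * (gamma * k / (2 * q0 * sqrt alpha) * exp (xi ^ 2))).
Proof.
intros hl hk hrho hc hq0 hh0 Halpha Hxi.
assert (halpha : 0 < alpha).
{ rewrite Halpha; apply Rdiv_lt_0_compat; [|apply Rmult_lt_0_compat]; assumption. }
pose proof (sqrt_lt_R0 _ halpha) as Hsa.
(* Both fronts have the form [2 m sqrt (alpha t)], with [m = xi] for [s] and a larger bracket for
   [r] when [gamma > 0]. *)
assert (HDs : forall m t, 0 < t ->
  is_derive (fun t => 2 * m * sqrt (alpha * t)) t (m * sqrt alpha / sqrt t)).
{ intros m t Ht; pose proof (sqrt_lt_R0 _ Ht).
  assert (0 < alpha * t) by now apply Rmult_lt_0_compat.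
  auto_derive; [assumption|].
  rewrite sqrt_mult by lra.
  rewrite <- (sqrt_sqrt alpha) at 1 by lra.
  field; lra. }
assert (HDT : forall x t, 0 < t -> Derive (fun y => T_sol k alpha q0 xi y t) x
  = q0 / (k * sqrt t) * exp (- (x / (2 * sqrt (alpha * t))) ^ 2)).
{ intros x t Ht; now apply is_derive_unique, is_derive_T_sol_x. }
(* The formula for [T] is smooth in [x] on the whole line, so the one-sided limits at 0 and at the
   front are plain values. *)
assert (HcT : forall x t, 0 < t -> continuous (fun y => T_sol k alpha q0 xi y t) x).
{ intros x t Ht; apply (ex_derive_continuous (fun y => T_sol k alpha q0 xi y t)).
  eexists; now apply is_derive_T_sol_x. }
assert (HcT' : forall x t, 0 < t ->
  continuous (Derive (fun y => T_sol k alpha q0 xi y t)) x).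
{ intros x t Ht.
  apply (ex_derive_continuous (Derive (fun y => T_sol k alpha q0 xi y t))).
  eapply ex_derive_ext; [intros z; symmetry; apply HDT, Ht|].
  eexists; now apply is_derive_T_sol_xx. }
(* The similarity variable is constantly [xi] along the front. *)
assert (Hs : forall t, 0 < t -> s_sol alpha xi t / (2 * sqrt (alpha * t)) = xi).
{ intros t Ht; unfold s_sol.
  assert (0 < sqrt (alpha * t)) by now apply sqrt_lt_R0, Rmult_lt_0_compat.
  field; lra. }
assert (H0 : forall t, 0 < t -> 0 / (2 * sqrt (alpha * t)) = 0).
{ intros t Ht; unfold Rdiv; ring. }
assert (Heat : forall x t, 0 < t -> is_derive_n (fun y => T_sol k alpha q0 xi y t) 2 x
  (- q0 * x / (2 * alpha * k * t * sqrt t) * exp (- (x / (2 * sqrt (alpha * t))) ^ 2))).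
{ intros x t Ht; simpl.
  eapply is_derive_ext; [intros z; symmetry; apply HDT, Ht|].
  now apply is_derive_T_sol_xx. }
split.
- intros [_ _ _ _ _ Hflux _ Hface]; split.
  (* The time [t = 1] removes the factor [sqrt t]; uniqueness of limits identifies the unnamed
     boundary values with those of the profile. *)
  + destruct (Hface 1 Rlt_0_1) as (T0 & p0 & HT0 & _ & Hp & Hq).
    assert (E : T0 = T_sol k alpha q0 xi 0 1).
    { apply (filterlim_locally_unique (V := R_NormedModule) _ _ _ HT0).
      apply (continuous_within _ _ _ (HcT 0 1 Rlt_0_1)). }
    unfold T_sol in E; rewrite H0, erf_0 in E by lra.
    rewrite Hq, E, sqrt_1, !Rdiv_1_r in Hp; lra.
  + destruct (Hflux 1 Rlt_0_1) as (ps & Hps & Hk & _).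
    assert (E : ps = Derive (fun y => T_sol k alpha q0 xi y 1) (s_sol alpha xi 1)).
    { apply (filterlim_locally_unique (V := R_NormedModule) _ _ _ Hps).
      apply (continuous_within _ _ _ (HcT' _ 1 Rlt_0_1)). }
    rewrite HDT, Hs in E by lra.
    unfold s_sol, r_sol in Hk.
    rewrite !(is_derive_unique _ _ _ (HDs _ 1 Rlt_0_1)), E, sqrt_1 in Hk.
    replace (q0 * exp (- xi ^ 2)) with (k * (q0 / (k * 1) * exp (- xi ^ 2)))
      by (field; lra).
    rewrite Hk; field; lra.
- intros [Hface Hflux]; constructor.
  + intros t Ht; unfold s_sol.
    assert (0 < sqrt (alpha * t)) by now apply sqrt_lt_R0, Rmult_lt_0_compat.
    nra.
  + intros x t Ht _; repeat split.
    * eexists; now apply is_derive_T_sol_t.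
    * eexists; now apply is_derive_T_sol_x.
    * eexists; now apply Heat.
  + intros x t Ht _; pose proof (sqrt_lt_R0 _ Ht).
    assert (Derive (fun tau => T_sol k alpha q0 xi x tau) t = - q0 * x / (2 * k * t * sqrt t)
      * exp (- (x / (2 * sqrt (alpha * t))) ^ 2)) as ->
      by now apply is_derive_unique, is_derive_T_sol_t.
    rewrite (is_derive_n_unique _ _ _ _ (Heat x t Ht)).
    (* The two derivatives satisfy [T_t = alpha T_xx], which is the heat equation once [alpha] is
       replaced by [k / (rho c)]. *)
    rewrite Halpha at 2.
    field; lra.
  + intros t Ht; split; eexists; now apply HDs.
  + intros t Ht.
    replace 0 with (T_sol k alpha q0 xi (s_sol alpha xi t) t) at 1
      by (unfold T_sol; rewrite Hs by assumption; ring).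
    apply (continuous_within _ _ _ (HcT _ _ Ht)).
  + intros t Ht; pose proof (sqrt_lt_R0 _ Ht).
    exists (q0 / (k * sqrt t) * exp (- xi ^ 2)); repeat split.
    * rewrite <- (Hs t Ht) at 2; rewrite <- HDT by assumption.
      apply (continuous_within _ _ _ (HcT' _ t Ht)).
    * unfold s_sol, r_sol.
      rewrite !(is_derive_unique _ _ _ (HDs _ t Ht)).
      replace (k * (q0 / (k * sqrt t) * exp (- xi ^ 2)))
        with (q0 * exp (- xi ^ 2) / sqrt t) by (field; lra).
      rewrite Hflux; field; lra.
    (* The factor [exp (xi^2)] in [r] cancels the [exp (- xi^2)] of the gradient at the front,
       leaving [gamma]. *)
    * unfold s_sol, r_sol.
      rewrite sqrt_mult, exp_Ropp by lra; pose proof (exp_pos (xi ^ 2)).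
      field; lra.
  + unfold s_sol, r_sol; rewrite Rmult_0_r, sqrt_0; split; ring.
  + intros t Ht; pose proof (sqrt_lt_R0 _ Ht).
    exists (T_sol k alpha q0 xi 0 t), (q0 / (k * sqrt t)); repeat split.
    * apply (continuous_within _ _ _ (HcT 0 t Ht)).
    * replace (q0 / (k * sqrt t)) with (Derive (fun y => T_sol k alpha q0 xi y t) 0).
      { apply (continuous_within _ _ _ (HcT' 0 t Ht)). }
      rewrite HDT, H0 by assumption.
      replace (- 0 ^ 2) with 0 by ring; rewrite exp_0; ring.
    * field; lra.
    * unfold T_sol; rewrite H0, erf_0 by assumption.
      replace (k * (q0 / (k * sqrt t))) with (q0 / sqrt t) by (field; lra).
      rewrite Hface at 1; field; lra.
Qed.

(** * Solvability of the two equations *)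

Lemma sqrt_eq_of_sqr (x y : R) : 0 <= y -> y * y = x -> sqrt x = y.
Proof. intros Hy <-; now apply sqrt_square. Qed.

(** Reduces the equivalence of two equations to one algebraic identity that [field] can check. *)
Lemma eq_iff_of_scaled_difference (x1 y1 x2 y2 a : R) :
  a <> 0 -> x1 - y1 = a * (x2 - y2) -> (x1 = y1 <-> x2 = y2).
Proof.
intros Ha H; split; intros E.
- assert (a * (x2 - y2) = 0) as [Ha0 | Hd]%Rmult_integral by lra; [contradiction | lra].
- assert (x1 - y1 = 0) by (rewrite H, E; ring); lra.
Qed.

Theorem theorem3p3 (l k rho c gamma q0 h0 Dinf : R)
  (hl : 0 < l) (hk : 0 < k) (hrho : 0 < rho) (hc : 0 < c)
  (hgamma : 0 < gamma) (hq0 : 0 < q0) (hh0 : 0 < h0) (hDinf : 0 < Dinf) :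
  let alpha := k / (rho * c) in
  let y := Dinf / q0 * sqrt (k * rho * c / PI) * (1 - q0 / (h0 * Dinf)) in
  let is_sol (eps xi : R) :=
    0 < eps < 1 /\ 0 < xi /\
    solves_P l k rho c gamma q0 h0 Dinf eps
      (T_sol k alpha q0 xi) (s_sol alpha xi) (r_sol k alpha gamma q0 xi) in
  ((exists eps xi : R, is_sol eps xi) <->
     (1 - q0 / (h0 * Dinf) > 0 /\
      y < 1 /\
      f2 (erf_inv y) < q0 / l * sqrt (c / (rho * k)) /\
      gamma * sqrt (k * rho * c) / (2 * q0) * exp (2 * erf_inv y ^ 2)
        + f2 (erf_inv y) > q0 / l * sqrt (c / (rho * k)))) /\
  (forall eps xi : R, is_sol eps xi ->
     xi = erf_inv y /\
     eps = 1 - 2 * q0 / (gamma * sqrt (k * rho * c))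
               * (q0 / l * sqrt (c / (rho * k)) - f2 xi)
               * exp (- 2 * xi ^ 2)).
Proof.
intros alpha y is_sol.
pose proof PI_RGT_0; pose proof sqrt_PI_pos as HsPI.
assert (Hrc : 0 < rho * c) by now apply Rmult_lt_0_compat.
assert (Halpha : 0 < alpha) by now apply Rdiv_lt_0_compat.
pose proof (sqrt_lt_R0 _ Halpha) as Ha.
assert (Haa : sqrt alpha * sqrt alpha = alpha) by (apply sqrt_sqrt; lra).
(* Since [rho c = k / alpha], every root in the statement can be expressed through [sqrt alpha] and
   [sqrt PI], so that the later identities become rational. *)
assert (S1 : sqrt (k * rho * c) = k / sqrt alpha).
{ apply sqrt_eq_of_sqr; [apply Rlt_le, Rdiv_lt_0_compat; lra|].
  replace (k / sqrt alpha * (k / sqrt alpha)) with (k * k / (sqrt alpha * sqrt alpha))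
    by (field; lra).
  rewrite Haa; unfold alpha; field; lra. }
assert (S2 : sqrt (k * rho * c / PI) = k / (sqrt alpha * sqrt PI)).
{ rewrite sqrt_div_alt, S1 by lra; field; lra. }
assert (S3 : sqrt (c / (rho * k)) = 1 / (rho * sqrt alpha)).
{ apply sqrt_eq_of_sqr.
  { apply Rlt_le, Rdiv_lt_0_compat; [lra | now apply Rmult_lt_0_compat]. }
  replace (1 / (rho * sqrt alpha) * (1 / (rho * sqrt alpha)))
    with (1 / (rho * rho * (sqrt alpha * sqrt alpha))) by (field; lra).
  rewrite Haa; unfold alpha; field; lra. }
set (K := gamma * sqrt (k * rho * c) / (2 * q0)).
set (B := q0 / l * sqrt (c / (rho * k))).
assert (HK : 0 < K).
{ unfold K; rewrite S1; apply Rdiv_lt_0_compat; [|lra].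
  apply Rmult_lt_0_compat; [lra | apply Rdiv_lt_0_compat; lra]. }
assert (Hexp : forall x, exp (2 * x ^ 2) = exp (x ^ 2) * exp (x ^ 2)).
{ intros x; rewrite <- exp_plus; f_equal; ring. }
assert (Hsol : forall eps xi, is_sol eps xi <->
  0 < eps < 1 /\ 0 < xi /\ erf xi = y /\ B - f2 xi = (1 - eps) * (K * exp (2 * xi ^ 2))).
{ intros eps xi; unfold is_sol.
  assert (HT : 0 < xi ->
    (solves_P l k rho c gamma q0 h0 Dinf eps
      (T_sol k alpha q0 xi) (s_sol alpha xi) (r_sol k alpha gamma q0 xi) <->
     erf xi = y /\ B - f2 xi = (1 - eps) * (K * exp (2 * xi ^ 2)))).
  { intros Hxi.
    rewrite (solves_P_similarity_iff l k rho c gamma q0 h0 Dinf eps alpha xi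
      hl hk hrho hc hq0 hh0 eq_refl Hxi).
    apply Morphisms_Prop.and_iff_morphism.
    (* The scale is the coefficient of [erf xi] in the convective condition. *)
    - apply (eq_iff_of_scaled_difference _ _ _ _ (h0 * q0 * (sqrt PI * sqrt alpha) / k)).
      + apply Rgt_not_eq, Rdiv_lt_0_compat; [|lra].
        repeat apply Rmult_lt_0_compat; lra.
      + unfold y; rewrite S2, sqrt_mult by lra; field; lra.
    - pose proof (exp_pos (xi ^ 2)).
      apply (eq_iff_of_scaled_difference _ _ _ _ (rho * l * sqrt alpha / exp (xi ^ 2))).
      + apply Rgt_not_eq, Rdiv_lt_0_compat; [|lra].
        repeat apply Rmult_lt_0_compat; lra.
      + unfold B, K, f2; rewrite S1, S3, Hexp, exp_Ropp; field; lra. }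
  tauto. }
assert (Hy : 0 < y <-> 1 - q0 / (h0 * Dinf) > 0).
(* [y] is a positive multiple of the bracket in the first inequality. *)
{ assert (0 < Dinf / q0 * sqrt (k * rho * c / PI)).
  { rewrite S2; repeat first [apply Rdiv_lt_0_compat | apply Rmult_lt_0_compat]; lra. }
  unfold y; split; intros; nra. }
assert (HKe : forall x, 0 < K * exp (2 * x ^ 2)).
{ intros x; apply Rmult_lt_0_compat; [exact HK | apply exp_pos]. }
split; [split|].
- intros (eps & xi & (Heps & Hxi & Herf & Hflux)%Hsol).
  rewrite <- Hy, <- Herf, (erf_inv_erf xi Hxi).
  specialize (HKe xi).
  (* The last two goals amount to [0 < B - f2 xi < K exp (2 xi^2)], which is the flux equation with
     [0 < 1 - eps < 1]. *)
  repeat split; [now apply erf_pos | apply erf_lt_1 | nra | nra].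
- intros (Hy0%Hy & Hy1 & Hlo & Hhi).
  destruct (erf_inv_spec y) as [Hxi Herf]; [lra|].
  specialize (HKe (erf_inv y)).
  (* The first witness solves the linear flux equation for [eps]. *)
  exists (1 - (B - f2 (erf_inv y)) / (K * exp (2 * erf_inv y ^ 2))), (erf_inv y).
  apply Hsol; repeat split; try assumption.
  + apply Rlt_0_minus, Rlt_div_l; lra.
  + assert (0 < (B - f2 (erf_inv y)) / (K * exp (2 * erf_inv y ^ 2)))
      by (apply Rdiv_lt_0_compat; lra).
    lra.
  + pose proof (exp_pos (2 * erf_inv y ^ 2)); field; lra.
- intros eps xi (Heps & Hxi & Herf & Hflux)%Hsol.
  split; [now rewrite <- Herf, erf_inv_erf|].
  fold B; rewrite Hflux.
  replace (-2 * xi ^ 2) with (- (2 * xi ^ 2)) by ring.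
  pose proof (exp_pos (2 * xi ^ 2)).
  assert (0 < k / sqrt alpha) by (apply Rdiv_lt_0_compat; lra).
  rewrite exp_Ropp; unfold K; rewrite S1; field; lra.
Qed.
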